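(* Let $a$ and $b$ be positive coprime integers and let $h$ be a natural number. With $n$, $H$, $S(\cdot,\cdot;\cdot)$ and $\eta_2(a,b,h)$ defined from $a,b,h$ as in the context, $$S(a,b;h)+S(b,a;H)=\eta_2(a,b,h).$$
   Context: Notation: $\lfloor x\rfloor$ is the floor of $x$ and $\{x\}=x-\lfloor x\rfloor$ its fractional part. ''Remainder upon division by $m$'' means the least nonnegative residue, in $\{0,1,\dots,m-1\}$. Empty sums are $0$. For positive coprime integers $a,b$ and an upper limit $h$ define $$S(a,b;h):=\frac a2\sum_{i=1}^{h}\left\{\frac{ib}{a}\right\}^2+\left(\frac a2+1\right)\sum_{i=1}^{h}\left\lfloor\frac{ib}{a}\right\rfloor .$$ Accordingly $$S(b,a;H)=\frac b2\sum_{i=1}^{H}\left\{\frac{ia}{b}\right\}^2+\left(\frac b2+1\right)\sum_{i=1}^{H}\left\lfloor\frac{ia}{b}\right\rfloor .$$ Given $a,b,h$: - $n_0$ is the remainder when $-b(h+1)$ is divided by $a$; - $n:=ab-a+n_0$ (so $ab-a\le n<ab$); - $n_1$ is the remainder when $-na^{-1}$ is divided by $b$, where $a^{-1}$ is an inverse of $a$ modulo $b$; - $H:=n_1-1$. Further define $$\alpha(a,b):=\frac{ab(a+b-2)}{2},$$ $$\beta(a,b):=\frac{ab(a-1)(b-1)}{2}+\frac{ab\left((a-1)(a-2)+(b-1)(b-2)\right)}{3},$$ $$\gamma(a,b):=\frac{2\alpha(a,b)^2-ab\,\beta(a,b)}{2(ab)^3},$$ $$\begin{aligned}\eta_1(a,b,h):=\;&(h+H+1)+n\gamma(a,b)+\frac{n(n+3)}{2}\left(\frac{a+b-2}{2ab}\right)+\frac{n^3+6n^2+11n}{6ab}\\&+\frac{(h+1)(a-1)(a-5)}{12a}+\frac{(H+1)(b-1)(b-5)}{12b}-\frac{bh(h+1)(a+2)}{4a}-\frac{aH(H+1)(b+2)}{4b},\end{aligned}$$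 $$\eta_2(a,b,h):=\frac{(n+1)(n+2)}{2}+\frac{(a-1)(b-1)(2ab-a-b-6n-7)}{12}-\eta_1(a,b,h).$$
   Formalization: The identity is false for arbitrary h (e.g. a=b=1, h=0: left side 0, right side 1); it is proved under the added hypothesis that either h<a and n_1≠0, or a≤h<2a and n_1=0, which are exactly the cases where it holds. *)

(* Defs.v *)
From mathcomp Require Import all_boot all_order all_algebra.
Set Implicit Arguments.
Unset Strict Implicit.
Unset Printing Implicit Defensive.
Import Order.TTheory GRing.Theory Num.Theory.
Local Open Scope ring_scope.

Definition ratfloor (x : rat) : rat := (Num.floor x)%:~R.
Definition ratfrac (x : rat) : rat := x - ratfloor x.

(* The upper limit is an integer because it may be -1 (see [Hlim]); *)
(* [Num.truncn h] is 0 for h < 0, so the sums are then empty.       *)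
Definition Ssum (a b : nat) (h : int) : rat :=
  a%:R / 2 * (\sum_(1 <= i < (Num.truncn h).+1)
                 ratfrac (i%:R * b%:R / a%:R) ^+ 2)
  + (a%:R / 2 + 1) * (\sum_(1 <= i < (Num.truncn h).+1)
                         ratfloor (i%:R * b%:R / a%:R)).

(* For a positive modulus, [%%] on int is the least nonnegative residue. *)
Definition n0 (a b h : nat) : int :=
  (- (b%:Z * (h%:Z + 1)) %% a%:Z)%Z.

Definition n (a b h : nat) : int := a%:Z * b%:Z - a%:Z + n0 a b h.

(* Bezout coefficient u in u * a + v * b = gcd(a, b): an inverse of a modulo *)
(* b when a and b are coprime. [n1] does not depend on which inverse is used. *)
Definition modinv (a b : nat) : int := (egcdz a%:Z b%:Z).1.

Definition n1 (a b h : nat) : int :=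
  (- (n a b h * modinv a b) %% b%:Z)%Z.

(* Subtraction in int, so H = -1 when n1 = 0. *)
Definition Hlim (a b h : nat) : int := n1 a b h - 1.

Definition alpha (a b : nat) : rat :=
  let a : rat := a%:R in let b : rat := b%:R in
  a * b * (a + b - 2) / 2.

Definition beta (a b : nat) : rat :=
  let a : rat := a%:R in let b : rat := b%:R in
  a * b * (a - 1) * (b - 1) / 2
  + a * b * ((a - 1) * (a - 2) + (b - 1) * (b - 2)) / 3.

Definition gamma (a b : nat) : rat :=
  let ab : rat := a%:R * b%:R in
  (2 * alpha a b ^+ 2 - ab * beta a b) / (2 * ab ^+ 3).

Definition eta1 (a b h : nat) : rat :=
  let g := gamma a b in
  let n : rat := (n a b h)%:~R in
  let H : rat := (Hlim a b h)%:~R in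
  let a : rat := a%:R in let b : rat := b%:R in let h : rat := h%:R in
  (h + H + 1) + n * g
  + n * (n + 3) / 2 * ((a + b - 2) / (2 * a * b))
  + (n ^+ 3 + 6 * n ^+ 2 + 11 * n) / (6 * a * b)
  + (h + 1) * (a - 1) * (a - 5) / (12 * a)
  + (H + 1) * (b - 1) * (b - 5) / (12 * b)
  - b * h * (h + 1) * (a + 2) / (4 * a)
  - a * H * (H + 1) * (b + 2) / (4 * b).

Definition eta2 (a b h : nat) : rat :=
  let e1 := eta1 a b h in
  let n : rat := (n a b h)%:~R in
  let a : rat := a%:R in let b : rat := b%:R in
  (n + 1) * (n + 2) / 2
  + (a - 1) * (b - 1) * (2 * a * b - a - b - 6 * n - 7) / 12
  - e1.

(* Main.v *)
(* Modulo a and modulo b one sees that ab divides n + b(h+1) + a n1, and the  *)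
(* bounds force this sum to be 2ab.  If n1 > 0, put k = a - 1 - h; then H is  *)
(* the floor of kb/a.  The sum over i <= h is the sum over a full period,     *)
(* where the residues of ib mod a run over 0, ..., a-1, minus its tail, which *)
(* i -> a - i turns into a sum over i <= k.  No lattice point of the k x H    *)
(* rectangle lies on the line of slope b/a, so counting its points, with      *)
(* weights 1, 2i-1 and 2j-1, eliminates all the remaining floor sums.  If     *)
(* n1 = 0, then b(h+1-a) <= a and the floors past i = a all equal b.          *)
Require Import Defs.
From mathcomp Require Import all_boot all_order all_algebra.
From mathcomp Require Import ring lra zify.
Import Order.TTheory GRing.Theory Num.Theory.
Local Open Scope ring_scope.

(** By [n_eq], [eta2] becomes a rational function of a, b, h and n1, so only the left side has to be
    computed. If n1 > 0, [sum_Sterm_period] and [Sterm_reflect] turn S(a,b;h) into an explicit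
    full-period sum minus a tail. That tail and S(b,a;H) involve six floor sums;
    [sum_lattice_points], with F m = m and F m = m^2, gives three relations among them. The
    coefficients a/2 and a/2 + 1 of S are such that [sum_Sterm_reciprocity] removes all six. If n1 =
    0, S(b,a;H) is empty and the terms from i = a on are explicit. *)

Lemma ratfloor_divn (m d : nat) :
  (0 < d)%N -> ratfloor (m%:R / d%:R) = (m %/ d)%:R.
Proof.
move=> d_gt0; have d0 : 0 < d%:R :> rat by rewrite ltr0n.
rewrite /ratfloor (@floor_def _ _ (m %/ d)%N%:Z) ?pmulrn //.
rewrite -[_ + 1]/(Posz _ + 1%:Z) -PoszD -!pmulrn ler_pdivlMr // ltr_pdivrMr //.
by rewrite -!natrM ler_nat ltr_nat leq_trunc_div addn1 ltn_ceil.
Qed.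

Lemma ratfrac_divn (m d : nat) :
  (0 < d)%N -> ratfrac (m%:R / d%:R) = (m %% d)%:R / d%:R.
Proof.
move=> d_gt0; rewrite /ratfrac ratfloor_divn // {1}(divn_eq m d) natrD natrM.
by field; rewrite pnatr_eq0; lia.
Qed.

Definition Sterm (a b i : nat) : rat :=
  (i * b %% a)%:R ^+ 2 / (2 * a%:R) + (a%:R / 2 + 1) * (i * b %/ a)%:R.

Lemma Ssum_nat (a b h : nat) : (0 < a)%N ->
  Ssum a b h%:Z = \sum_(i < h) Sterm a b i.+1.
Proof.
move=> a_gt0; rewrite /Ssum -[h%:Z]natz natrK !big_add1 /= !big_mkord.
rewrite !mulr_sumr -big_split /=; apply: eq_bigr => i _.
rewrite -natrM ratfrac_divn // ratfloor_divn // /Sterm.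
by congr (_ + _); field; rewrite pnatr_eq0; lia.
Qed.

(** * Sums over a full period *)

Lemma sum_ord_natr (k : nat) :
  \sum_(i < k) i%:R = k%:R * (k%:R - 1) / 2 :> rat.
Proof.
elim: k => [|k IHk]; first by rewrite big_ord0; field.
by rewrite big_ord_recr /= IHk; field.
Qed.

Lemma sum_ord_natr_sqr (k : nat) :
  \sum_(i < k) i%:R ^+ 2 = k%:R * (k%:R - 1) * (2 * k%:R - 1) / 6 :> rat.
Proof.
elim: k => [|k IHk]; first by rewrite big_ord0; field.
by rewrite big_ord_recr /= IHk; field.
Qed.

(** Multiplication by [b] permutes the residues modulo [a]. *)
Lemma sum_modn_coprime (V : nmodType) (F : nat -> V) (a b : nat) :
  coprime a b -> \sum_(i < a) F (i * b %% a)%N = \sum_(i < a) F i.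
Proof.
case: a => [|a] co_ab; first by rewrite !big_ord0.
pose p (i : 'I_a.+1) : 'I_a.+1 := inord (i * b %% a.+1).
have valp i : p i = (i * b %% a.+1)%N :> nat by rewrite inordK // ltn_mod.
have p_inj : injective p.
  suff le_inj (i j : 'I_a.+1) : (i <= j)%N -> p i = p j -> i = j.
    move=> i j pij; case/orP: (leq_total i j) => /le_inj; first exact.
    by move/(_ (esym pij)).
  move=> le_ij /(congr1 val); rewrite /= !valp => /eqP.
  rewrite eq_sym eqn_mod_dvd ?leq_mul2r ?le_ij ?orbT // -mulnBl Gauss_dvdl //.
  move=> dvd_ij; apply: ord_inj; have := ltn_ord j.
  by have [|/dvdn_leq/(_ dvd_ij)] := posnP (j - i); lia.
by rewrite [RHS](reindex_inj p_inj); apply: eq_bigr => i _; rewrite valp.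
Qed.

Lemma sum_Sterm_period (a b : nat) : (0 < a)%N -> coprime a b ->
  \sum_(i < a) Sterm a b i =
    (a%:R - 1) * (2 * a%:R - 1) / 12
    + (a%:R / 2 + 1) * (a%:R - 1) * (b%:R - 1) / 2.
Proof.
move=> a_gt0 co_ab; rewrite big_split /= -mulr_suml -mulr_sumr.
have sum_r := sum_modn_coprime rat (fun r => r%:R) a b co_ab.
have sum_r2 := sum_modn_coprime rat (fun r => r%:R ^+ 2) a b co_ab.
(* Summing ib = aq + r over the period yields the floor sum, since the remainders r sum to a known
   value. *)
have : b%:R * \sum_(i < a) i%:R =
    a%:R * \sum_(i < a) (i * b %/ a)%:R + \sum_(i < a) (i * b %% a)%:R :> rat.
  rewrite !mulr_sumr -big_split; apply: eq_bigr => i _ /=.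
  rewrite -!natrM -natrD; congr _%:R.
  by rewrite mulnC {1}(divn_eq (i * b) a) mulnC.
rewrite sum_r sum_r2 sum_ord_natr sum_ord_natr_sqr => eq_q.
have -> : \sum_(i < a) (i * b %/ a)%:R = (a%:R - 1) * (b%:R - 1) / 2 :> rat.
  have a0 : a%:R != 0 :> rat by rewrite pnatr_eq0; lia.
  by apply: (mulfI a0); lra.
by field; rewrite pnatr_eq0; lia.
Qed.

(** * Reflection of the tail and lattice points *)

(** Write ib = aq + r. Since a does not divide i, r > 0, so (a-i)b = (b-1-q)a + (a-r) is again a
    Euclidean division. *)
Lemma divn_modn_reflect (a b i : nat) : coprime a b -> (0 < i < a)%N ->
  ((a - i) * b %/ a = b - 1 - i * b %/ a)%N /\
  ((a - i) * b %% a = a - i * b %% a)%N.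
Proof.
move=> co_ab /andP[i_gt0 lt_ia]; have a_gt0 : (0 < a)%N by lia.
have r_gt0 : (0 < i * b %% a)%N.
  rewrite lt0n; apply/negP => /eqP r0.
  have : (a %| i * b)%N by rewrite /dvdn r0.
  by rewrite Gauss_dvdl // => /dvdn_leq; lia.
have r_lt := ltn_pmod (i * b) a_gt0.
have E := divn_eq (i * b) a.
have -> : ((a - i) * b = (b - 1 - i * b %/ a) * a + (a - i * b %% a))%N.
  have b_gt0 : (0 < b)%N by case: (b) r_gt0; rewrite // muln0 mod0n.
  have q_lt : (i * b %/ a < b)%N by rewrite ltn_divLR // mulnC ltn_pmul2l.
  have : ((a - i) * b + (i * b %/ a * a + i * b %% a) = a * b)%N.
    by rewrite -E -mulnDl subnK // ltnW.
  move: r_lt q_lt; move: (i * b %% a)%N (i * b %/ a)%N => r q.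
  move=> r_lt q_lt.
  have -> : (a * b = (b - 1 - q) * a + q * a + a)%N by nia.
  by move: ((a - i) * b)%N ((b - 1 - q) * a)%N (q * a)%N => x y z; lia.
have lt_ra : (a - i * b %% a < a)%N by rewrite ltn_subrL r_gt0.
by rewrite divnMDl // modnMDl (divn_small lt_ra) (modn_small lt_ra) addn0.
Qed.

(** The remainder is expressed as ib - aq, so that the floor q is the only quantity not polynomial
    in a, b, i. *)
Lemma Sterm_reflect (a b i : nat) : coprime a b -> (0 < i < a)%N ->
  let q : rat := (i * b %/ a)%:R in
  Sterm a b (a - i) =
    (a%:R - (i%:R * b%:R - a%:R * q)) ^+ 2 / (2 * a%:R)
    + (a%:R / 2 + 1) * (b%:R - 1 - q).
Proof.
move=> co_ab i_bnd q; rewrite /Sterm /q.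
have [-> ->] := divn_modn_reflect a b i co_ab i_bnd.
have E := divn_eq (i * b) a.
have a_gt0 : (0 < a)%N by lia.
have r_lt := ltn_pmod (i * b) a_gt0.
have b_gt0 : (0 < b)%N.
  case: (posnP b) => [b0|//]; move: co_ab i_bnd; rewrite b0 /coprime gcdn0.
  by move=> /eqP->; lia.
have q_lt : (i * b %/ a < b)%N.
  by rewrite ltn_divLR // mulnC ltn_pmul2l //; case/andP: i_bnd.
have -> : i%:R * b%:R - a%:R * (i * b %/ a)%:R = (i * b %% a)%:R :> rat.
  by rewrite -natrM {1}E natrD natrM; ring.
by rewrite -subnDA !natrB ?natrD ?opprD ?addrA ?add1n // ltnW.
Qed.

Lemma sum_ord_split_rev (V : nmodType) (F : nat -> V) (m k : nat) :
  \sum_(i < m + k) F i = \sum_(i < m) F i + \sum_(i < k) F (m + k - i.+1)%N.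
Proof.
rewrite big_split_ord /=; congr (_ + _); rewrite (reindex_inj rev_ord_inj).
by apply: eq_bigr => i _; congr F; rewrite /=; have := ltn_ord i; lia.
Qed.

(* Both sides weigh the points of the k x H rectangle by the increments of F: *)
(* f counts the points of a row on one side of the diagonal, g those of a     *)
(* column on the other side.                                                  *)
Lemma sum_lattice_points (R : pzRingType) (F : nat -> R) (f g : nat -> nat)
    (k H : nat) :
  F 0%N = 0 ->
  (forall i, (i < k)%N -> (f i <= H)%N) ->
  (forall j, (j < H)%N -> (g j <= k)%N) ->
  (forall i j, (i < k)%N -> (j < H)%N -> (j < f i)%N = ~~ (i < g j)%N) ->
  \sum_(i < k) F (f i) + \sum_(j < H) (F j.+1 - F j) *+ g j = F H *+ k.
Proof.
move=> F0 f_le g_le fg; pose D j := F j.+1 - F j.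
have sumD m : \sum_(j < m) D j = F m.
  by rewrite -(big_mkord xpredT) telescope_sumr // F0 subr0.
have widen (V : nmodType) (G : nat -> V) m M : (m <= M)%N ->
    \sum_(j < m) G j = \sum_(j < M) (if (j < m)%N then G j else 0).
  by move=> le_mM; rewrite (big_ord_widen _ _ le_mM) big_mkcond.
have -> : \sum_(i < k) F (f i) =
    \sum_(j < H) \sum_(i < k) (if (j < f i)%N then D j else 0).
  rewrite exchange_big; apply: eq_bigr => i _.
  by rewrite -sumD; apply: widen; exact: f_le.
rewrite -sumD -sumrMnl -big_split; apply: eq_bigr => j _ /=.
rewrite -[g j]card_ord -sumr_const (widen _ (fun=> D j) _ k) ?g_le //.
rewrite -[k in RHS]card_ord -sumr_const -big_split; apply: eq_bigr => i _ /=.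
by rewrite fg //; case: (i < g j)%N; rewrite ?addr0 ?add0r.
Qed.

(** * Reciprocity when H is the floor of kb/a *)

Section Reciprocity.

Variables (a b k H : nat).
Hypotheses (a_gt0 : (0 < a)%N) (b_gt0 : (0 < b)%N) (co_ab : coprime a b).
Hypotheses (lt_ka : (k < a)%N) (leH : (H * a <= k * b)%N).
Hypothesis (gtH : (k * b < H.+1 * a)%N).

Let f i := (i.+1 * b %/ a)%N.
Let g j := (j.+1 * a %/ b)%N.

Let f_le i : (i < k)%N -> (f i <= H)%N.
Proof. by move=> ltik; rewrite -ltnS /f ltn_divLR //; nia. Qed.

Let g_le j : (j < H)%N -> (g j <= k)%N.
Proof. by move=> ltjH; rewrite -ltnS /g ltn_divLR //; nia. Qed.

(** No point lies on the diagonal: (j+1)a = (i+1)b would make a divide i+1, which is at most k <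
    a. *)
Let fg i j : (i < k)%N -> (j < H)%N -> (j < f i)%N = ~~ (i < g j)%N.
Proof.
move=> ltik ltjH; rewrite /f /g !leq_divRL // -ltnNge.
rewrite ltn_neqAle andb_idl // => _; apply/eqP => eq_ab.
have : (a %| i.+1 * b)%N by rewrite -eq_ab dvdn_mull.
by rewrite Gauss_dvdl // => /dvdn_leq; lia.
Qed.

Let gf j i : (j < H)%N -> (i < k)%N -> (i < g j)%N = ~~ (j < f i)%N.
Proof. by move=> ltjH ltik; rewrite fg // negbK. Qed.

(** The second sum is the reflected tail; it is subtracted because S(a,b;h) is the full period minus
    that tail. *)
Lemma sum_Sterm_reciprocity :
  \sum_(j < H) Sterm b a j.+1 - \sum_(i < k) Sterm a b (a - i.+1) =
  let a : rat := a%:R in let b : rat := b%:R in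
  let k : rat := k%:R in let H : rat := H%:R in
  a ^+ 2 / (2 * b) * (H * (H + 1) * (2 * H + 1) / 6)
  - b ^+ 2 / (2 * a) * (k * (k + 1) * (2 * k + 1) / 6)
  - k * a / 2 + b * (k * (k + 1) / 2) - (a / 2 + 1) * (b - 1) * k
  + (b / 2 - a / 2 + 1) * k * H
  - a / 2 * k * H ^+ 2 + b / 2 * H * k ^+ 2.
Proof.
pose sf : rat := \sum_(i < k) (f i)%:R.
pose sg : rat := \sum_(j < H) (g j)%:R.
pose sf2 : rat := \sum_(i < k) (f i)%:R ^+ 2.
pose sg2 : rat := \sum_(j < H) (g j)%:R ^+ 2.
pose sif : rat := \sum_(i < k) i%:R * (f i)%:R.
pose sjg : rat := \sum_(j < H) j%:R * (g j)%:R.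
have card : sf + sg = k%:R * H%:R.
  rewrite [RHS]mulr_natl -(sum_lattice_points rat (fun m => m%:R) f g) //.
  by congr (_ + _); apply: eq_bigr => j _; rewrite -natr1 addrAC subrr add0r.
(* For F m = m^2 the increments are 2j+1; [weight_g] is the same count with rows and columns
   exchanged. *)
have weight_f : sf2 + (2 * sjg + sg) = k%:R * H%:R ^+ 2.
  rewrite [RHS]mulr_natl -(sum_lattice_points rat (fun m => m%:R ^+ 2) f g) //.
  congr (_ + _); rewrite mulr_sumr -big_split; apply: eq_bigr => j _ /=.
  by rewrite -mulr_natr -natr1; ring.
have weight_g : sg2 + (2 * sif + sf) = H%:R * k%:R ^+ 2.
  rewrite [RHS]mulr_natl -(sum_lattice_points rat (fun m => m%:R ^+ 2) g f) //.
  congr (_ + _); rewrite mulr_sumr -big_split; apply: eq_bigr => i _ /=.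
  by rewrite -mulr_natr -natr1; ring.
have sum1 m : \sum_(i < m) 1 = m%:R :> rat by rewrite sumr_const card_ord.
have a0 : a%:R != 0 :> rat by rewrite pnatr_eq0; lia.
have b0 : b%:R != 0 :> rat by rewrite pnatr_eq0; lia.
have sum_b : \sum_(j < H) Sterm b a j.+1 =
    a%:R ^+ 2 / (2 * b%:R) * \sum_(j < H) j%:R ^+ 2
    + a%:R ^+ 2 / b%:R * \sum_(j < H) j%:R
    + a%:R ^+ 2 / (2 * b%:R) * \sum_(j < H) 1
    + (- a%:R) * sjg + (b%:R / 2 + 1 - a%:R) * sg + b%:R / 2 * sg2.
  rewrite !mulr_sumr -!big_split; apply: eq_bigr => j _ /=.
  rewrite /Sterm -/(g j).
  have -> : (j.+1 * a %% b)%:R = (j%:R + 1) * a%:R - (g j)%:R * b%:R :> rat.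
    rewrite natr1 -!natrM /g {2}(divn_eq (j.+1 * a) b) natrD.
    by rewrite addrAC subrr add0r.
  by field.
have sum_a : \sum_(i < k) Sterm a b (a - i.+1) =
    b%:R ^+ 2 / (2 * a%:R) * \sum_(i < k) i%:R ^+ 2
    + (b%:R ^+ 2 / a%:R - b%:R) * \sum_(i < k) i%:R
    + ((a%:R - b%:R) ^+ 2 / (2 * a%:R) + (a%:R / 2 + 1) * (b%:R - 1))
      * \sum_(i < k) 1
    + (- b%:R) * sif + (a%:R / 2 - 1 - b%:R) * sf + a%:R / 2 * sf2.
  rewrite !mulr_sumr -!big_split; apply: eq_bigr => i _ /=.
  have lt_ia : (0 < i.+1 < a)%N by have := ltn_ord i; lia.
  by rewrite (Sterm_reflect a b i.+1) // -/(f i) -natr1; field.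
rewrite sum_a sum_b !sum1 !sum_ord_natr !sum_ord_natr_sqr.
(* Substituting for [sf2] and [sg2] cancels [sjg] and [sif], and leaves [sf] and [sg] with the same
   coefficient b/2 - a/2 + 1, so only their sum kH survives. *)
have -> : sf = k%:R * H%:R - sg by rewrite -card addrK.
have -> : sf2 = k%:R * H%:R ^+ 2 - (2 * sjg + sg) by rewrite -weight_f addrK.
have -> : sg2 = H%:R * k%:R ^+ 2 - (2 * sif + (k%:R * H%:R - sg)).
  by rewrite -weight_g -card; ring.
by cbv zeta; field; apply/andP.
Qed.

End Reciprocity.

(** * The value of n, and the two cases of the theorem *)

(** Modulo a, n is congruent to n0, hence to -b(h+1); modulo b, the Bezout relation makes a n1
    congruent to -n. *)
Lemma n1_congr (a b h : nat) : (0 < a)%N -> (0 < b)%N -> coprime a b ->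
  (a%:Z * b%:Z %| n a b h + b%:Z * (h%:Z + 1) + a%:Z * n1 a b h)%Z.
Proof.
move=> a_gt0 b_gt0 co_ab; rewrite Gauss_dvdz //; apply/andP; split.
  rewrite rpredD ?dvdz_mulr // /n /n0.
  set x := b%:Z * _; have E := divz_eq (- x) a%:Z.
  apply/dvdzP; exists (b%:Z - 1 - (- x %/ a%:Z)%Z).
  move: E; move: (- x %/ _)%Z (- x %% _)%Z => q r E.
  by have -> : r = - x - q * a%:Z by [rewrite E; ring]; ring.
rewrite addrAC rpredD ?dvdz_mulr //= /n1 /modinv.
case: egcdzP => u v; rewrite /gcdz /= (eqP co_ab) => bezout _.
set N := n a b h; have E := divz_eq (- (N * u)) b%:Z.
apply/dvdzP; exists (N * v - a%:Z * (- (N * u) %/ b%:Z)%Z).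
move: E; move: (_ %/ _)%Z (_ %% _)%Z => q r E.
have -> : r = - (N * u) - q * b%:Z by rewrite E; ring.
have NE : N = N * (u * a%:Z + v * b%:Z) by rewrite bezout mulr1.
by rewrite {1}NE; ring.
Qed.

Lemma n1_bounds (a b h : nat) : (0 < b)%N -> 0 <= n1 a b h < b%:Z.
Proof. by move=> b_gt0; rewrite modz_ge0 ?ltz_pmod //; lia. Qed.

Lemma n_bounds (a b h : nat) : (0 < a)%N ->
  a%:Z * b%:Z - a%:Z <= n a b h < a%:Z * b%:Z.
Proof.
move=> a_gt0; rewrite /n.
have : 0 <= n0 a b h < a%:Z by rewrite modz_ge0 ?ltz_pmod //; lia.
by move: (a%:Z * b%:Z) => ab; lia.
Qed.

(** In both ranges n + b(h+1) + a n1 is a multiple of ab strictly between ab and 3ab. *)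
Lemma n_eq (a b h : nat) : (0 < a)%N -> (0 < b)%N -> coprime a b ->
  (h < a)%N /\ n1 a b h <> 0 \/ (a <= h < 2 * a)%N /\ n1 a b h = 0 ->
  n a b h = 2 * a%:Z * b%:Z - b%:Z * (h%:Z + 1) - a%:Z * n1 a b h.
Proof.
move=> a_gt0 b_gt0 co_ab h_range.
have /dvdzP[c E] := n1_congr a b h a_gt0 b_gt0 co_ab.
have := n_bounds a b h a_gt0; have := n1_bounds a b h b_gt0.
move: (n a b h) (n1 a b h) h_range E => N N1 h_range E N1_bnd N_bnd.
suff c2 : c = 2 by rewrite c2 in E; lia.
have ab_gt0 : 0 < a%:Z * b%:Z :> int by nia.
suff : 1 * (a%:Z * b%:Z) < c * (a%:Z * b%:Z) < 3 * (a%:Z * b%:Z).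
  by rewrite !ltr_pM2r //; lia.
rewrite -E; case: h_range => -[h_bnd N1_neq0].
  have : b%:Z * (h%:Z + 1) <= b%:Z * a%:Z by rewrite ler_pM2l //; lia.
  have : a%:Z * N1 <= a%:Z * (b%:Z - 1) by rewrite ler_pM2l //; lia.
  have : a%:Z <= a%:Z * N1 by rewrite ler_peMr //; lia.
  have : b%:Z <= b%:Z * (h%:Z + 1) by rewrite ler_peMr //; lia.
  by lia.
rewrite N1_neq0.
have : b%:Z * (a%:Z + 1) <= b%:Z * (h%:Z + 1) by rewrite ler_pM2l //; lia.
have : b%:Z * (h%:Z + 1) <= b%:Z * (2 * a%:Z) by rewrite ler_pM2l //; lia.
have : a%:Z <= a%:Z * b%:Z by rewrite ler_peMr //; lia.
by lia.
Qed.

Lemma Sterm0 (a b : nat) : Sterm a b 0 = 0.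
Proof. by rewrite /Sterm mul0n mod0n div0n expr0n mul0r mulr0 addr0. Qed.

Theorem theorem6 (a b h : nat) (a_gt0 : (0 < a)%N) (b_gt0 : (0 < b)%N)
    (co_ab : coprime a b)
    (* the identity fails for every other triple *)
    (h_range : (h < a)%N /\ n1 a b h <> 0
               \/ (a <= h < 2 * a)%N /\ n1 a b h = 0) :
  Ssum a b h%:Z + Ssum b a (Hlim a b h) = eta2 a b h.
Proof.
have N_eq := n_eq a b h a_gt0 b_gt0 co_ab h_range.
have N_bnd := n_bounds a b h a_gt0.
have a0 : a%:R != 0 :> rat by rewrite pnatr_eq0; lia.
have b0 : b%:R != 0 :> rat by rewrite pnatr_eq0; lia.
have period := sum_Sterm_period a b a_gt0 co_ab.
have N_rat : (n a b h)%:~R =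
    2 * a%:R * b%:R - b%:R * (h%:R + 1) - a%:R * (n1 a b h)%:~R :> rat.
  by rewrite N_eq; ring.
rewrite Ssum_nat // /eta2 /eta1 /gamma /alpha /beta; cbv zeta.
rewrite N_rat /Hlim; move: N_eq h_range.
have := n1_bounds a b h b_gt0.
case: (n1 a b h) => [[|H]|//] N1_bnd N_eq [[h_bnd N1_neq0]|[h_bnd N1_eq0]] //.
(* Here H = -1, which truncates to 0, so both sums in S(b,a;H) are empty. *)
- rewrite /Ssum [X in _ + X](_ : _ = 0) ?addr0; last first.
    by rewrite !big_geq // !mulr0 addr0.
  pose m := (h.+1 - a)%N; have h_eq : (h.+1 = a + m)%N by lia.
  (* This is n >= ab - a, as n = 2ab - b(h+1). It gives (a+i)b quotient b and remainder ib modulo a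
     for i < m. *)
  have mb_le : (m * b <= a)%N by nia.
  have term i : (i < m)%N ->
      Sterm a b (a + i) = b%:R ^+ 2 / (2 * a%:R) * i%:R ^+ 2
                          + (a%:R / 2 + 1) * b%:R * 1.
    move=> lt_im; have lt_ib : (i * b < a)%N by nia.
    rewrite /Sterm mulnDl (mulnC a) modnMDl divnMDl // modn_small //.
    by rewrite divn_small // addn0 natrM; field.
  have -> : \sum_(i < h) Sterm a b i.+1 = \sum_(i < h.+1) Sterm a b i.
    by rewrite big_ord_recl Sterm0 add0r.
  rewrite h_eq big_split_ord /= period.
  rewrite (eq_bigr _ (fun (i : 'I_m) _ => term i (ltn_ord i))) big_split /=.
  rewrite -!mulr_sumr sum_ord_natr_sqr sumr_const card_ord.
  have -> : h%:R = a%:R + m%:R - 1 :> rat by rewrite -natrD -h_eq -natr1 addrK.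
  by field; apply/andP.
- have -> : (H.+1%:Z - 1 = H%:Z)%R by lia.
  rewrite Ssum_nat //; pose k := (a - h.+1)%N.
  have a_eq : (h.+1 + k = a)%N by lia.
  have := sum_ord_split_rev _ (Sterm a b) h.+1 k.
  rewrite a_eq period big_ord_recl Sterm0 add0r => period_split.
  (* The conditions on H left open here are the bounds on n, because kb - aH = n - (ab - a). *)
  have recip : _ = _ := sum_Sterm_reciprocity a b k H a_gt0 b_gt0 co_ab _ _ _.
  have -> : \sum_(i < h) Sterm a b i.+1 =
      \sum_(i < h) Sterm a b (lift ord0 i) by [].
  rewrite -[\sum_(i < h) _](addrK (\sum_(i < k) Sterm a b (a - i.+1))).
  rewrite -period_split addrAC -addrA recip /=; [|nia..].
  have -> : h%:R = a%:R - k%:R - 1 :> rat.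
    by rewrite -[a in RHS]a_eq natrD -natr1; ring.
  by field; apply/andP.
Qed.
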